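(* Consider the planted clique problem with $n\to\infty$, clique-size parameter $k=k_n$ and $\rho=k/n$. Suppose there is a fixed $\epsilon>0$ with $k\le n^{1/2-\epsilon}$ for all $n$, and $D=D_n$ satisfies $D=o\big((\log n/\log\log n)^2\big)$. Then $\mathrm{MMSE}_{\le D}\ge\rho-(1+o(1))\rho^2$.
   Context: Planted clique problem: $v\in\{0,1\}^n$ has i.i.d. $\mathrm{Bernoulli}(\rho)$ entries; conditionally on $v$, for each pair $i<j$ independently, $Y_{ij}=1$ if $v_iv_j=1$ and otherwise $Y_{ij}\sim\mathrm{Bernoulli}(1/2)$; the observation is $Y=(Y_{ij})_{i<j}$; the target is $x=v_1$. $\mathrm{MMSE}_{\le D}=\inf_f\mathbb{E}(f(Y)-x)^2$ over real polynomials $f$ of degree at most $D$ in the entries of $Y$. Asymptotic notation refers to $n\to\infty$. *)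

(* Defs.v *)
From HB Require Import structures.
From mathcomp Require Import all_boot all_order all_algebra.
From mathcomp Require Import mpoly.
From mathcomp Require Import classical_sets reals.
Set Implicit Arguments. Unset Strict Implicit. Unset Printing Implicit Defensive.
Import Order.TTheory GRing.Theory Num.Theory.
Local Open Scope ring_scope.
Local Open Scope classical_set_scope.

Definition edge (n : nat) := {p : 'I_n * 'I_n | (p.1 < p.2)%N}.

Definition vvec (n : nat) := {ffun 'I_n -> bool}.
Definition obs (n : nat) := {ffun edge n -> bool}.

Section PlantedClique.
Variables (R : realType) (n : nat) (rho : R).

Definition prob_v (v : vvec n) : R :=
  \prod_(i : 'I_n) (if v i then rho else 1 - rho).

Definition prob_Y_given_v (v : vvec n) (Y : obs n) : R :=
  \prod_(e : edge n)
    (if v (val e).1 && v (val e).2 then (if Y e then 1 else 0) else 2^-1).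

(* target x = v_1 (the first vertex, index 0); as a real number *)
Definition target (v : vvec n) : R :=
  \sum_(i : 'I_n | nat_of_ord i == 0%N) (v i)%:R.

Definition Yvars (Y : obs n) : 'I_#|{: edge n}| -> R :=
  fun i => (Y (enum_val i))%:R.

Definition polyY := {mpoly R[#|{: edge n}|]}.

(* total degree at most D  (msize p = 1 + total degree of p; msize 0 = 0) *)
Definition deg_le (D : nat) (f : polyY) : Prop := (msize f <= D.+1)%N.

Definition mse (f : polyY) : R :=
  \sum_(v : vvec n) \sum_(Y : obs n)
     prob_v v * prob_Y_given_v v Y * (meval (Yvars Y) f - target v) ^+ 2.

Definition MMSE_le (D : nat) : R :=
  inf [set mse f | f in [set f : polyY | deg_le D f]].

End PlantedClique.

(* Main.v *)
Require Import Defs.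
From HB Require Import structures.
From mathcomp Require Import all_boot all_order all_algebra.
From mathcomp Require Import all_classical all_reals all_analysis.
From mathcomp Require Import (canonicals) mpoly.
From mathcomp Require Import fintype finset.
From mathcomp Require Import ring lra zify.
Set Implicit Arguments. Unset Strict Implicit. Unset Printing Implicit Defensive.
Import Order.TTheory GRing.Theory Num.Theory.
Local Open Scope ring_scope.

(** Let [x_e] indicate that both endpoints of the edge [e] are planted and let
    [s = 1] or [-1] be the spin of [Y_e].  Take
    [W = \sum_(|b| <= D) w_b \prod_(e in b) (1 - x_e) s_e], with the weights [w]
    chosen so that [E(W chi_a) = E(v_1 chi_a)] for all spin monomials [chi_a] of
    degree at most [D]: this is a triangular linear system.  Then
    [E(W f) = E(v_1 f)] for every admissible [f], and expanding
    [E(f - W)^2 >= 0] gives [E(f - v_1)^2 >= rho - E(W^2) >= rho - \sum_b w_b^2].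

    The empty set has weight [rho]; inductively, the other weights satisfy
    [|w_a| <= (8(D+1))^|a| rho^(1 + |U_a|)], with [U_a] the set of vertices of [a]
    other than the first one.  Grouping the [a] by [U = U_a] and using
    [|a| <= 2 sqrt(D) |U|], the squares of these weights sum to at most
    [rho^2 ((1 + beta)^n - 1)], where [beta = 2 rho^2 (512 (D+1)^4)^(2 sqrt D)].
    The assumption on [D] makes the last power [n^o(1)], so [n beta] tends to 0. *)

Lemma prodr_bool (R : comNzRingType) (I : finType) (P b : pred I) :
  \prod_(i | P i) (b i)%:R = [forall (i | P i), b i]%:R :> R.
Proof.
case: (boolP [forall (i | P i), b i]) => [/forall_inP h|].
  by rewrite big1 // => i Pi; rewrite h.
rewrite negb_forall => /existsP[i]; rewrite negb_imply => /andP[Pi /negPf bi].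
by rewrite (bigD1 i) //= bi mul0r.
Qed.

(** * Moments of spin characters under the planted measure *)

Section Moments.
Variables (R : realType) (n : nat) (rho : R).
Implicit Types (v : vvec n) (Y : obs n) (a b c : {set edge n}).

Definition planted v (e : edge n) := v (val e).1 && v (val e).2.

(** The sum over [Y] stays inside, so that every moment is first computed conditionally on [v]. *)
Definition expect (F : vvec n -> obs n -> R) : R :=
  \sum_v prob_v rho v * \sum_Y prob_Y_given_v R v Y * F v Y.

Lemma eq_expect F G : (forall v Y, F v Y = G v Y) -> expect F = expect G.
Proof.
by move=> FG; apply: eq_bigr => v _; congr (_ * _); apply: eq_bigr => Y _; rewrite FG.
Qed.

Lemma expectD F G : expect (fun v Y => F v Y + G v Y) = expect F + expect G.
Proof.
rewrite -big_split /=; apply: eq_bigr => v _; rewrite -mulrDr -big_split /=.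
by congr (_ * _); apply: eq_bigr => Y _; rewrite mulrDr.
Qed.

Lemma expectZ k F : expect (fun v Y => k * F v Y) = k * expect F.
Proof.
rewrite mulr_sumr; apply: eq_bigr => v _; rewrite mulrCA; congr (_ * _).
by rewrite mulr_sumr; apply: eq_bigr => Y _; rewrite mulrCA.
Qed.

Lemma expect_sum (I : finType) (P : pred I) (k : I -> R) F :
  expect (fun v Y => \sum_(i | P i) k i * F i v Y) =
  \sum_(i | P i) k i * expect (F i).
Proof.
transitivity (\sum_(i | P i) expect (fun v Y => k i * F i v Y)); last first.
  by apply: eq_bigr => i _; rewrite expectZ.
rewrite exchange_big /=; apply: eq_bigr => v _; rewrite -mulr_sumr exchange_big /=.
by congr (_ * _); apply: eq_bigr => Y _; rewrite mulr_sumr.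
Qed.

Lemma mseE (f : polyY R n) :
  mse rho f = expect (fun v Y => (mpoly.meval (Yvars R Y) f - target R v) ^+ 2).
Proof.
apply: eq_bigr => v _; rewrite mulr_sumr.
by apply: eq_bigr => Y _; rewrite mulrA.
Qed.

Lemma prob_Y_ge0 v Y : 0 <= prob_Y_given_v R v Y.
Proof. by apply: prodr_ge0 => e _; do 2 case: ifP => _ //; rewrite invr_ge0. Qed.

Lemma prob_v_ge0 v : 0 <= rho <= 1 -> 0 <= prob_v rho v.
Proof.
by case/andP=> r0 r1; apply: prodr_ge0 => e _; case: ifP => _ //; rewrite subr_ge0.
Qed.

Lemma expect_ge0 F : 0 <= rho <= 1 -> (forall v Y, 0 <= F v Y) -> 0 <= expect F.
Proof.
move=> r01 F0; apply: sumr_ge0 => v _; rewrite mulr_ge0 ?prob_v_ge0 //.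
by apply: sumr_ge0 => Y _; rewrite mulr_ge0 // prob_Y_ge0.
Qed.

Lemma cond_prod v (F : edge n -> bool -> R) :
  \sum_Y prob_Y_given_v R v Y * \prod_e F e (Y e) =
  \prod_e (if planted v e then F e true else 2^-1 * (F e true + F e false)).
Proof.
pose G e y := (if planted v e then if y then 1 else 0 else 2^-1) * F e y.
transitivity (\sum_(Y : obs n) \prod_e G e (Y e)).
  by apply: eq_bigr => Y _; rewrite big_split.
rewrite -(bigA_distr_bigA G); apply: eq_bigr => e _.
by rewrite big_bool /G; case: ifP => _ /=; ring.
Qed.

Definition spin (y : bool) : R := if y then 1 else -1.

Definition chi a Y : R := \prod_(e in a) spin (Y e).

(* The conditional expectation given [v] and [Y] of the character of [b] in the
   underlying unplanted observation: it vanishes once [b] has a planted edge. *)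
Definition xi b v Y : R := \prod_(e in b) ((~~ planted v e)%:R * spin (Y e)).

(** Edge by edge, the case where the factor of [xi b * chi a] has conditional mean 1; otherwise that
    mean is 0. *)
Definition compat b a v :=
  [forall e, if e \in b then (e \in a) && ~~ planted v e
             else (e \in a) ==> planted v e].

Lemma xi0 v Y : xi set0 v Y = 1.
Proof. by rewrite /xi big_set0. Qed.

Lemma chi0 Y : chi set0 Y = 1.
Proof. by rewrite /chi big_set0. Qed.

(** Given [v] the edges are independent; an unplanted spin has mean 0 and square 1, a planted one
    equals 1. *)
Lemma cond_xi_chi v b a :
  \sum_Y prob_Y_given_v R v Y * (xi b v Y * chi a Y) = (compat b a v)%:R.
Proof.
pose F e y := (if e \in b then (~~ planted v e)%:R * spin y else 1) *
              (if e \in a then spin y else 1).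
transitivity (\sum_Y prob_Y_given_v R v Y * \prod_e F e (Y e)).
  apply: eq_bigr => Y _; congr (_ * _).
  by rewrite [RHS]big_split /= -!big_mkcond.
rewrite cond_prod.
transitivity (\prod_e (if e \in b then (e \in a) && ~~ planted v e
                       else (e \in a) ==> planted v e)%:R : R); last first.
  by rewrite prodr_bool; congr (nat_of_bool _)%:R; apply: eq_forallb.
apply: eq_bigr => e _.
rewrite /F /spin; case: (planted v e); case: (e \in b); case: (e \in a) => /=;
  by rewrite ?mul0r ?mulr1 ?mul1r //; field.
Qed.

(** Orthogonality: an unplanted edge in exactly one of [b] and [c] averages to 0, and a planted edge
    in either gives a zero factor. *)
Lemma cond_xi_xi v b c :
  \sum_Y prob_Y_given_v R v Y * (xi b v Y * xi c v Y) =
  ((b == c) && compat b b v)%:R.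
Proof.
pose F e y := (if e \in b then (~~ planted v e)%:R * spin y else 1) *
              (if e \in c then (~~ planted v e)%:R * spin y else 1).
transitivity (\sum_Y prob_Y_given_v R v Y * \prod_e F e (Y e)).
  apply: eq_bigr => Y _; congr (_ * _).
  by rewrite [RHS]big_split /= -!big_mkcond.
rewrite cond_prod.
transitivity ([forall e : edge n, ((e \in b) == (e \in c)) &&
                ((e \in b) ==> ~~ planted v e)]%:R : R).
  transitivity (\prod_e (((e \in b) == (e \in c)) &&
                ((e \in b) ==> ~~ planted v e))%:R : R); last first.
    by rewrite prodr_bool; congr (nat_of_bool _)%:R; apply: eq_forallb.
  apply: eq_bigr => e _.
  rewrite /F /spin; case: (planted v e); case: (e \in b); case: (e \in c) => /=;
  by rewrite ?mul0r ?mulr1 ?mul1r //; field.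
congr (nat_of_bool _)%:R; apply/forallP/andP => [h|[/eqP <- /forallP h] e].
  split; first by apply/eqP/setP => e; case/andP: (h e) => /eqP.
  apply/forallP => e; case/andP: (h e) => _.
  by case: (e \in b).
by rewrite eqxx /=; have := h e; case: (e \in b).
Qed.

(* The entries of the triangular system: for [b \subset a], the probability that
   all edges of [a :\: b] and none of [b] are planted. *)
Definition ov b a : R := \sum_v prob_v rho v * (compat b a v)%:R.

Lemma expect_xi_chi b a : expect (fun v Y => xi b v Y * chi a Y) = ov b a.
Proof. by apply: eq_bigr => v _; rewrite cond_xi_chi. Qed.

Lemma expect_xi_xi b c :
  expect (fun v Y => xi b v Y * xi c v Y) = (b == c)%:R * ov b b.
Proof.
rewrite /ov mulr_sumr; apply: eq_bigr => v _; rewrite cond_xi_xi.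
by rewrite mulrCA; case: eqP => _ /=; rewrite ?mul1r ?mul0r ?mulr0.
Qed.

Lemma prob_v_all (A : {set 'I_n}) :
  \sum_v prob_v rho v * [forall (i | i \in A), v i]%:R = rho ^+ #|A|.
Proof.
pose G (i : 'I_n) (x : bool) :=
  (if x then rho else 1 - rho) * (if i \in A then x%:R else 1).
transitivity (\sum_(v : vvec n) \prod_i G i (v i)).
  by apply: eq_bigr => v _; rewrite -prodr_bool [RHS]big_split /= -big_mkcond.
rewrite -(bigA_distr_bigA G) -prodr_const [RHS]big_mkcond /=.
by apply: eq_bigr => i _; rewrite big_bool /G /=; case: ifP => _ ; rewrite ?mulr1 ?mulr0 ?addr0 // addrC subrK.
Qed.

Lemma prob_v_sum : \sum_(v : vvec n) prob_v rho v = 1.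
Proof.
have := prob_v_all set0; rewrite cards0 expr0 => <-.
apply: eq_bigr => v _.
have -> : [forall (i | i \in set0), v i] by apply/forall_inP => i; rewrite inE.
by rewrite mulr1.
Qed.

Definition verts a : {set 'I_n} := \bigcup_(e in a) [set (val e).1; (val e).2].

Lemma forall_verts a v :
  [forall (i | i \in verts a), v i] = [forall (e | e \in a), planted v e].
Proof.
apply/forall_inP/forall_inP => [h e ea|h i /bigcupP[e ea]].
  by rewrite /planted !h //; apply/bigcupP; exists e; rewrite ?inE ?eqxx ?orbT.
by have /andP[h1 h2] := h e ea; rewrite !inE => /orP[] /eqP ->.
Qed.

Hypothesis r01 : 0 <= rho <= 1.

Lemma ov_ge0 b a : 0 <= ov b a.
Proof. by apply: sumr_ge0 => v _; rewrite mulr_ge0 ?prob_v_ge0. Qed.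

Lemma ov_sub b a : ov b a <= rho ^+ #|verts (a :\: b)|.
Proof.
rewrite -prob_v_all; apply: ler_sum => v _; rewrite ler_wpM2l ?prob_v_ge0 //.
rewrite ler_nat forall_verts.
case: (boolP (compat b a v)) => // /forallP h.
rewrite lt0b; apply/forall_inP => e; rewrite inE => /andP[eb ea].
by have := h e; rewrite (negPf eb) ea.
Qed.

(** This makes the system triangular for inclusion. *)
Lemma ov_eq0 b a : ~~ (b \subset a) -> ov b a = 0.
Proof.
move=> /subsetPn[e eb ea]; apply: big1 => v _.
rewrite (_ : compat b a v = false) ?mulr0 //; apply/negbTE.
by rewrite negb_forall; apply/existsP; exists e; rewrite eb (negPf ea).
Qed.

(** Union bound: [compat a a] fails only if some edge of [a] is planted, an event of probability
    [rho ^+ 2] for each edge. *)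
Lemma ov_diag a : 1 - #|a|%:R * rho ^+ 2 <= ov a a.
Proof.
have planted2 e : \sum_v prob_v rho v * (planted v e)%:R = rho ^+ 2.
  rewrite (_ : 2%N = #|[set (val e).1; (val e).2]|); last first.
    by rewrite cards2 neq_ltn (valP e).
  rewrite -prob_v_all; apply: eq_bigr => v _; congr (_ * _%:R).
  congr nat_of_bool; apply/andP/forall_inP => [[h1 h2] i|h].
    by rewrite !inE => /orP[] /eqP ->.
  by split; apply: h; rewrite !inE eqxx ?orbT.
have -> : 1 - #|a|%:R * rho ^+ 2 =
    \sum_(v : vvec n) prob_v rho v * (1 - \sum_(e in a) (planted v e)%:R).
  rewrite -{1}prob_v_sum; under [RHS]eq_bigr => v _ do rewrite mulrBr mulr1 mulr_sumr.
  rewrite sumrB; congr (_ - _); rewrite exchange_big /=.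
  by rewrite (eq_bigr (fun=> rho ^+ 2)) // sumr_const mulr_natl.
apply: ler_sum => v _; rewrite ler_wpM2l ?prob_v_ge0 //.
case: (boolP (compat a a v)) => [_|].
  by rewrite lerBlDr lerDl sumr_ge0.
rewrite negb_forall => /existsP[e]; case: ifP => [ea|->] //=.
rewrite ea /= negbK => pe; rewrite (bigD1 e) //= pe subr_le0 lerDl.
by rewrite sumr_ge0.
Qed.

Lemma ov00 : ov set0 set0 = 1.
Proof.
rewrite -prob_v_sum; apply: eq_bigr => v _.
have -> : compat set0 set0 v by apply/forallP => e; rewrite inE.
by rewrite mulr1.
Qed.

Variable i0 : 'I_n.
Hypothesis i0E : i0 = 0%N :> nat.

Lemma targetE v : target R v = (v i0)%:R.
Proof.
rewrite /target (big_pred1 i0) // => i /=.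
by rewrite -i0E; apply/eqP/eqP => [/val_inj|->].
Qed.

(** Averaging over [Y] leaves only the [v] that plant every edge of [a]; the target adds the vertex
    [i0]. *)
Lemma expect_target_chi a :
  expect (fun v Y => target R v * chi a Y) = rho ^+ #|i0 |: verts a|.
Proof.
rewrite -prob_v_all; apply: eq_bigr => v _; congr (_ * _).
rewrite targetE.
transitivity ((v i0)%:R * \sum_Y prob_Y_given_v R v Y * (xi set0 v Y * chi a Y)).
  by rewrite mulr_sumr; apply: eq_bigr => Y _; rewrite xi0 mul1r mulrCA.
rewrite cond_xi_chi -natrM mulnb; congr (nat_of_bool _)%:R.
have -> : compat set0 a v = [forall (i | i \in verts a), v i].
  rewrite forall_verts; apply: eq_forallb => e.
  by rewrite inE.
apply/andP/forall_inP => [[h0 /forall_inP h] i|h].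
  by rewrite in_setU1 => /predU1P[->//|]; exact: h.
by split; [|apply/forall_inP => i ia]; apply: h; rewrite in_setU1 ?eqxx ?ia ?orbT.
Qed.

Lemma expect_target2 : expect (fun v Y => target R v ^+ 2) = rho.
Proof.
transitivity (expect (fun v Y => target R v * chi set0 Y)).
  by apply: eq_expect => v Y; rewrite targetE chi0 mulr1; case: (v i0); rewrite ?expr1n ?expr0n.
by rewrite expect_target_chi /verts big_set0 setU0 cards1.
Qed.

(** Entries are 0 or 1, so only the support of [m] matters; there [Y e] is [(1 + spin (Y e)) / 2],
    and the product is expanded. *)
Lemma monomial_chi (m : edge n -> nat) Y :
  let S := [set e | m e != 0%N] in
  \prod_e (Y e)%:R ^+ m e =
  \sum_(a : {set edge n}) (a \subset S)%:R * 2^-1 ^+ #|S| * chi a Y.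
Proof.
move=> S.
have -> : \prod_e (Y e)%:R ^+ m e =
  \prod_e ((if e \in S then 2^-1 * spin (Y e) else 0) + (if e \in S then 2^-1 else 1)).
  apply: eq_bigr => e _; rewrite inE; case: eqP => [->|/eqP me] /=.
    by rewrite add0r.
  by rewrite /spin; case: (Y e); rewrite ?expr1n ?expr0n ?(negPf me) /=; field.
rewrite bigA_distr; apply: eq_bigr => a _.
case: (boolP (a \subset S)) => [/subsetP aS|/subsetPn[e ea eS]]; last first.
  by rewrite (bigD1 e) //= ea (negPf eS) !mul0r.
rewrite mul1r -prodr_const /chi [\prod_(e in S) _]big_mkcond [\prod_(e in a) _]big_mkcond.
rewrite -big_split /=; apply: eq_bigr => e _.
by case: (boolP (e \in a)) => [/aS ->|_] //; rewrite mulr1.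
Qed.

Lemma poly_chi D (f : polyY R n) : deg_le D f ->
  exists k : {set edge n} -> R, forall Y,
    mpoly.meval (Yvars R Y) f = \sum_(a : {set edge n} | (#|a| <= D)%N) k a * chi a Y.
Proof.
move=> fD.
pose S (m : mpoly.multinom #|{: edge n}|) :=
  [set e | mpoly.fun_of_multinom m (enum_rank e) != 0%N].
exists (fun a => \sum_(m <- mpoly.msupp f)
  mpoly.mcoeff m f * ((a \subset S m)%:R * 2^-1 ^+ #|S m|)) => Y.
rewrite mpoly.mevalE.
under [RHS]eq_bigr => a _ do rewrite mulr_suml.
rewrite exchange_big /=; apply: eq_big_seq => m mf.
under [RHS]eq_bigr => a _ do rewrite -mulrA.
rewrite -mulr_sumr; congr (_ * _).
rewrite (reindex (@enum_rank _)) /=; last first.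
  by apply: onW_bij; exact: enum_rank_bij.
under eq_bigr => e _ do rewrite /Yvars enum_rankK.
rewrite (monomial_chi (fun e => mpoly.fun_of_multinom m (enum_rank e))) /=.
rewrite [RHS]big_mkcond; apply: eq_bigr => a _.
case: (boolP (a \subset _)) => [aS|]; last by rewrite !mul0r if_same.
have aD : (#|a| <= D)%N.
  apply: leq_trans (subset_leq_card aS) _.
  have mD : (mpoly.mdeg m <= D)%N.
    by rewrite -ltnS; exact: leq_trans (mpoly.msize_mdeg_lt mf) fD.
  apply: leq_trans mD; rewrite mpoly.mdegE.
  rewrite (reindex (@enum_rank _)) /=; last first.
    by apply: onW_bij; exact: enum_rank_bij.
  rewrite -sum1_card big_mkcond /=; apply: leq_sum => e _.
  by rewrite inE; case: (mpoly.fun_of_multinom _ _).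
by rewrite aD.
Qed.

(** Duality: each solution [w] of the system up to degree [D] certifies a lower bound for all
    admissible [f] at once. *)
Lemma mse_ge_weights D (w : {set edge n} -> R) (f : polyY R n) :
  (forall a, (#|a| <= D)%N ->
     \sum_(b : {set edge n} | b \subset a) w b * ov b a = rho ^+ #|i0 |: verts a|) ->
  deg_le D f ->
  rho - \sum_(b : {set edge n} | (#|b| <= D)%N) w b ^+ 2 <= mse rho f.
Proof.
move=> wE fD; have [k fE] := poly_chi fD.
pose W v Y : R := \sum_(b : {set edge n} | (#|b| <= D)%N) w b * xi b v Y.
have EWchi a : (#|a| <= D)%N ->
    expect (fun v Y => W v Y * chi a Y) = expect (fun v Y => target R v * chi a Y).
  move=> aD; rewrite expect_target_chi -wE //.
  transitivity (\sum_(b : {set edge n} | (#|b| <= D)%N) w b * ov b a).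
    under eq_bigr => b _ do rewrite -expect_xi_chi.
    rewrite -expect_sum; apply: eq_expect => v Y; rewrite mulr_suml.
    by apply: eq_bigr => b _; rewrite mulrA.
  rewrite big_mkcond [RHS]big_mkcond; apply: eq_bigr => b _.
  case: (boolP (b \subset a)) => [/subset_leq_card/leq_trans ->//|/ov_eq0 ->].
  by rewrite mulr0 if_same.
have EWf : expect (fun v Y => W v Y * mpoly.meval (Yvars R Y) f) =
           expect (fun v Y => target R v * mpoly.meval (Yvars R Y) f).
  have aux (G : vvec n -> obs n -> R) :
      expect (fun v Y => G v Y * mpoly.meval (Yvars R Y) f) =
      \sum_(a : {set edge n} | (#|a| <= D)%N) k a * expect (fun v Y => G v Y * chi a Y).
    rewrite -expect_sum; apply: eq_expect => v Y; rewrite fE mulr_sumr.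
    by apply: eq_bigr => a _; rewrite mulrCA.
  by rewrite !aux; apply: eq_bigr => a aD; rewrite EWchi.
(* By orthogonality only the diagonal survives, and [ov b b] is a probability. *)
have EWW : expect (fun v Y => W v Y ^+ 2) <=
           \sum_(b : {set edge n} | (#|b| <= D)%N) w b ^+ 2.
  have -> : expect (fun v Y => W v Y ^+ 2) =
      \sum_(b : {set edge n} | (#|b| <= D)%N) w b *
        \sum_(c : {set edge n} | (#|c| <= D)%N) w c * ((b == c)%:R * ov b b).
    under eq_bigr => b _ do under eq_bigr => c _ do rewrite -expect_xi_xi.
    under eq_bigr => b _ do rewrite -expect_sum.
    rewrite -expect_sum; apply: eq_expect => v Y.
    rewrite expr2 {1}/W mulr_suml; apply: eq_bigr => b _; rewrite -mulrA.
    congr (_ * _); rewrite /W mulr_sumr; apply: eq_bigr => c _.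
    by rewrite mulrCA.
  apply: ler_sum => b bD; rewrite (bigD1 b) //= eqxx mul1r big1 ?addr0.
    rewrite mulrA -expr2 ler_piMr ?sqr_ge0 //.
    rewrite -prob_v_sum; apply: ler_sum => v _.
    by rewrite ler_piMr ?prob_v_ge0 // lern1 leq_b1.
  by move=> c /andP[_ cb]; rewrite eq_sym (negPf cb) mul0r mulr0.
rewrite mseE.
(* Pointwise, [(f - x)^2 = (f - W)^2 + 2 W f - 2 x f - W^2 + x^2]; the two middle terms cancel in
   mean by [EWf]. *)
have -> : expect (fun v Y => (mpoly.meval (Yvars R Y) f - target R v) ^+ 2) =
   expect (fun v Y => (mpoly.meval (Yvars R Y) f - W v Y) ^+ 2) +
   (2 * expect (fun v Y => W v Y * mpoly.meval (Yvars R Y) f) +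
   (- 2 * expect (fun v Y => target R v * mpoly.meval (Yvars R Y) f) +
   (-1 * expect (fun v Y => W v Y ^+ 2) + expect (fun v Y => target R v ^+ 2)))).
  by rewrite -!expectZ -!expectD; apply: eq_expect => v Y; ring.
have := @expect_ge0 (fun v Y => (mpoly.meval (Yvars R Y) f - W v Y) ^+ 2) r01
  (fun v Y => sqr_ge0 _).
rewrite expect_target2 EWf; lra.
Qed.

End Moments.

(** * Elementary tools: power bounds, subset sums, triangular systems *)

Lemma exp1D_le (R : realFieldType) (y : R) m :
  0 <= y -> 2 * m%:R * y <= 1 -> (1 + y) ^+ m <= 1 + 2 * m%:R * y.
Proof.
move=> y0; elim: m => [|m IHm]; first by rewrite expr0 mulr0 mul0r addr0.
rewrite -natr1 => my; rewrite exprS.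
have m0 : 0 <= m%:R :> R by [].
have my' : 2 * m%:R * y <= 1 by nra.
(* The quadratic term [2 m y^2] of this product is at most [y], by [my']. *)
apply: (@le_trans _ _ ((1 + y) * (1 + 2 * m%:R * y))).
  by rewrite ler_wpM2l ?IHm // addr_ge0.
nra.
Qed.

Lemma sum_subset_expr (R : comNzRingType) (I : finType) (A : {set I}) (y : R) :
  \sum_(B : {set I} | B \subset A) y ^+ #|B| = (1 + y) ^+ #|A|.
Proof.
transitivity (\prod_(i in A) (y + 1)); last by rewrite prodr_const addrC.
rewrite [RHS]big_mkcond.
transitivity (\prod_i ((if i \in A then y else 0) + 1)); last first.
  by apply: eq_bigr => i _; case: ifP => _ //; rewrite add0r.
rewrite bigA_distr [LHS]big_mkcond; apply: eq_bigr => B _.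
case: ifPn => [/fintype.subsetP BA|/subsetPn[i iB iA]]; last first.
  by rewrite (bigD1 i) //= iB (negPf iA) mul0r.
rewrite -prodr_const big_mkcond; apply: eq_bigr => i _.
by case: ifP => // /BA ->.
Qed.

(** Recursion on cardinality: the equation of [a] fixes [w a] once its proper subsets are known. The
    bound [m] restricts nondegeneracy to the sizes where it is available. *)
Lemma triangular_solve (R : fieldType) (I : finType) (M : {set I} -> {set I} -> R)
    (c : {set I} -> R) m :
  (forall a : {set I}, (#|a| < m)%N -> M a a != 0) ->
  exists w : {set I} -> R, forall a : {set I}, (#|a| < m)%N ->
    \sum_(b : {set I} | b \subset a) w b * M b a = c a.
Proof.
elim: m => [|m IHm] M0; first by exists (fun=> 0).
have [|w wE] := IHm; first by move=> a am; apply/M0/ltnW.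
exists (fun a : {set I} => if (#|a| < m)%N then w a else
  (c a - \sum_(b : {set I} | b \proper a) w b * M b a) / M a a) => a.
rewrite ltnS leq_eqVlt => /orP[/eqP am|am]; last first.
  rewrite -wE //; apply: eq_bigr => b /subset_leq_card ba.
  by rewrite (leq_ltn_trans ba am).
rewrite (bigD1 a) //= am ltnn divfK ?M0 ?am //.
apply/eqP; rewrite -[eqbRHS](subrK (\sum_(b : {set I} | b \proper a) w b * M b a)).
rewrite (inj_eq (addrI _)); apply/eqP; apply: eq_big => b.
  by rewrite properEneq andbC.
by rewrite andbC -properEneq => /proper_card; rewrite am => ->.
Qed.

(** * Counting edge sets by the vertices they touch *)

Section Counting.
Variables (R : realType) (n : nat) (i0 : 'I_n).
Hypothesis i0E : i0 = 0%N :> nat.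
Implicit Types (a b : {set edge n}) (U : {set 'I_n}).

Lemma card_verts a : (#|verts a| <= 2 * #|a|)%N.
Proof.
rewrite -[#|a|]sum1_card big_distrr /= /verts.
elim/big_rec2: _ => [|e k U _ IH]; first by rewrite cards0.
apply: leq_trans (leq_card_setU _ _) _; apply: leq_add => //.
by rewrite cards2; case: (_ != _).
Qed.

(** [i0] is adjoined because [verts a :\ i0] does not record whether [a] touches it. *)
Definition edges_in U : {set edge n} :=
  [set e | ((val e).1 \in i0 |: U) && ((val e).2 \in i0 |: U)].

Lemma card_edges_in U : (#|edges_in U| <= (#|U|.+1) ^ 2)%N.
Proof.
rewrite -(card_imset _ (@val_inj _ _ (edge n))).
apply: (@leq_trans #|setX (i0 |: U) (i0 |: U)|).
  apply/subset_leq_card/fintype.subsetP => p /imsetP[e + ->].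
  by rewrite inE => eU; rewrite inE.
by rewrite cardsX leq_mul // cardsU1 -add1n leq_add2r leq_b1.
Qed.

Lemma sub_edges_in a : a \subset edges_in (verts a :\ i0).
Proof.
apply/fintype.subsetP => e ea; rewrite inE.
have aux i : i \in verts a -> i \in i0 |: (verts a :\ i0).
  by move=> ia; rewrite !inE ia andbT orbN.
by rewrite !aux //; apply/bigcupP; exists e; rewrite // !inE eqxx ?orbT.
Qed.

Lemma verts_neq0 a : a != set0 -> verts a :\ i0 != set0.
Proof.
case/set0Pn => e ea; apply/set0Pn; exists (val e).2; rewrite !inE.
apply/andP; split; last by apply/bigcupP; exists e; rewrite // !inE eqxx orbT.
by apply/eqP => e2; have := valP e; rewrite /= e2 i0E ltn0.
Qed.

(** With [t] vertices besides [i0], both [s^2] and [(t + 1)^2 <= (2 t)^2] bound [#|a|]; multiply and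
    take the square root. *)
Lemma card_le_verts D s a : (D <= s ^ 2)%N -> a != set0 -> (#|a| <= D)%N ->
  (#|a| <= 2 * s * #|verts a :\ i0|)%N.
Proof.
move=> Ds a0 aD.
have h := leq_trans (subset_leq_card (sub_edges_in a)) (card_edges_in _).
have := verts_neq0 a0; rewrite -card_gt0.
move: h; set t := #|verts a :\ i0|; move=> h t0.
have t4 : (t.+1 ^ 2 <= (2 * t) ^ 2)%N by rewrite leq_exp2r //; lia.
rewrite -(@leq_exp2r _ _ 2) // -mulnA mulnCA expnMn -{1}[#|a|]muln1 -mulnn muln1.
exact: leq_mul (leq_trans aD Ds) (leq_trans h t4).
Qed.

Lemma card_vertsU a : #|i0 |: verts a| = #|verts a :\ i0|.+1.
Proof. by rewrite cardsU1 [in LHS](cardsD1 i0) addnA; case: (_ \in _). Qed.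

Lemma sum_edge_sets D s (p : R) : (D <= s ^ 2)%N -> 0 <= p ->
  \sum_(a : {set edge n} | (a != set0) && (#|a| <= D)%N)
     ((8 * D.+1)%:R ^+ 2) ^+ #|a| * p ^+ #|verts a :\ i0| <=
  \sum_(U : {set 'I_n} | U != set0) (2 * p * (512 * D.+1 ^ 4)%:R ^+ (2 * s)) ^+ #|U|.
Proof.
move=> Ds p0; set N := D.+1.
set L : R := (8 * N)%:R; set Z : R := (512 * N ^ 4)%:R.
rewrite (partition_big (fun a => verts a :\ i0) (fun U => U != set0)) /=; last first.
  by move=> a /andP[a0 _]; exact: verts_neq0.
apply: ler_sum => U U0.
have t0 : (0 < #|U|)%N by rewrite card_gt0.
have N0 : 1 <= N%:R :> R by rewrite ler1n.
have Z1 : 1 <= Z by rewrite ler1n muln_gt0 expn_gt0.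
have Z0 : 0 < Z by exact: lt_le_trans Z1.
(* At most [D] edges touch at most [2 * D] vertices, so a larger [U] has an empty fibre. *)
case: (leqP #|U| (2 * D)%N) => UD; last first.
  rewrite big1 ?exprn_ge0 ?mulr_ge0 ?exprn_ge0 ?(ltW Z0) // => a.
  move=> /andP[/andP[_ aD] /eqP aU]; move: UD; rewrite ltnNge.
  rewrite -aU (leq_trans (subset_leq_card (subD1set _ _))) //.
  by rewrite (leq_trans (card_verts a)) // leq_mul2l aD orbT.
(* Since [#|a| <= 2 * s * #|U|] and [1 <= Z], trading a power of [Z] for the bound
   on [#|a|] leaves a full binomial sum. *)
apply: (@le_trans _ _ (\sum_(a : {set edge n} | a \subset edges_in U)
    p ^+ #|U| * Z ^+ (2 * s * #|U|) * (L ^+ 2 / Z) ^+ #|a|)).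
  rewrite big_mkcond [leRHS]big_mkcond; apply: ler_sum => a _.
  have pos : 0 <= p ^+ #|U| * Z ^+ (2 * s * #|U|) * (L ^+ 2 / Z) ^+ #|a|.
    by rewrite !mulr_ge0 ?exprn_ge0 ?divr_ge0 ?exprn_ge0 // ltW.
  case: ifP => [/andP[/andP[a0 aD] /eqP aU]|_]; last by case: ifP.
  have -> : a \subset edges_in U by rewrite -aU sub_edges_in.
  rewrite aU mulrC -mulrA ler_wpM2l ?exprn_ge0 //.
  rewrite expr_div_n mulrCA ler_peMr ?exprn_ge0 // ler_pdivlMr ?exprn_gt0 // mul1r.
  by rewrite ler_weXn2l // -aU; apply: card_le_verts Ds _ _.
rewrite -mulr_sumr sum_subset_expr.
(* [Z] is chosen for this ratio: with at most [4 * N ^ 2] edges available, [exp1D_le] bounds the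
   binomial sum by 2. *)
have LZ : L ^+ 2 / Z = (8 * N%:R ^+ 2)^-1.
  rewrite /L /Z [(8 * N)%:R]natrM [(512 * _)%:R]natrM natrX; field.
  by rewrite pnatr_eq0.
have E4 : (#|edges_in U| <= 4 * N ^ 2)%N.
  by apply: leq_trans (card_edges_in U) _; rewrite /N; nia.
apply: (@le_trans _ _ (p ^+ #|U| * Z ^+ (2 * s * #|U|) * 2)).
  rewrite ler_wpM2l ?mulr_ge0 ?exprn_ge0 ?(ltW Z0) //.
  have small : 2 * #|edges_in U|%:R * (L ^+ 2 / Z) <= 1.
    rewrite LZ ler_pdivrMr ?mulr_gt0 ?exprn_gt0 ?(lt_le_trans _ N0) //.
    have : #|edges_in U|%:R <= 4 * N%:R ^+ 2 :> R.
      by rewrite -natrX -natrM ler_nat.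
    by lra.
  apply: le_trans (exp1D_le _ small) _; last lra.
  by rewrite divr_ge0 ?exprn_ge0 // ltW.
(* As [U] is nonempty, the 2 in the base absorbs the bound 2 on the binomial sum. *)
have -> : (2 * p * Z ^+ (2 * s)) ^+ #|U| =
    p ^+ #|U| * Z ^+ (2 * s * #|U|) * 2 ^+ #|U|.
  by rewrite !exprMn -exprM -mulrA mulrC.
rewrite ler_wpM2l ?mulr_ge0 ?exprn_ge0 ?(ltW Z0) //.
by rewrite -{1}[2]expr1 ler_weXn2l // ler1n.
Qed.

End Counting.

(** * Size of the weights, and the bound for fixed [n] *)

Section LowerBound.
Variables (R : realType) (n : nat) (rho : R) (i0 : 'I_n).
Hypothesis r01 : 0 <= rho <= 1.
Hypothesis i0E : i0 = 0%N :> nat.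
Implicit Types (a b : {set edge n}).

(** Strong induction on [#|a|]: solving for [w a] divides by a diagonal entry at least 1/2, and [L]
    is large enough to keep the contribution of the proper subsets small. *)
Lemma weights_bound D (w : {set edge n} -> R) (L : R) :
  (forall a, (#|a| <= D)%N ->
     \sum_(b : {set edge n} | b \subset a) w b * ov rho b a = rho ^+ #|i0 |: verts a|) ->
  D%:R * rho ^+ 2 <= 2^-1 -> 8 * D%:R <= L -> 8 <= L ->
  forall a, (#|a| <= D)%N -> `|w a| <= L ^+ #|a| * rho ^+ #|i0 |: verts a|.
Proof.
have quarter (x : R) : 8 <= x -> 1 + 4^-1 * x <= 2^-1 * x by lra.
move=> wE Dr LD L8 a; have [r0 r1] := andP r01.
have L0 : 0 < L by lra.
have L1 : 1 <= L by lra.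
have [m] := ubnP #|a|; elim: m a => // m IHm a; rewrite ltnS => am aD.
have := wE _ aD; rewrite (bigD1 a) //=.
rewrite (eq_bigl (fun b => b \proper a)); last first.
  by move=> b; rewrite properEneq andbC.
(* The empty set is treated apart: [8 <= L ^+ #|a|] below needs a nonempty [a]. *)
have [->|a0] := eqVneq a set0.
  rewrite big_pred0 => [|b]; last by rewrite properE subset0; case: eqP => [->|]; rewrite ?sub0set.
  rewrite ov00 mulr1 addr0 => ->.
  by rewrite cards0 mul1r ger0_norm // exprn_ge0.
have a1 : (0 < #|a|)%N by rewrite card_gt0.
set q := rho ^+ _; set S := (X in _ + X = _) => wS.
have q0 : 0 <= q by rewrite exprn_ge0.
have ov2 : 2^-1 <= ov rho a a.
  apply: le_trans (ov_diag r01 a); rewrite lerBrDr -lerBrDl.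
  apply: (@le_trans _ _ 2^-1); last by lra.
  by apply: le_trans Dr; rewrite ler_wpM2r ?exprn_ge0 // ler_nat.
(* By induction [b] contributes at most [q * L ^+ #|b|]; these terms form a binomial sum without its
   top term. *)
have S_le : `|S| <= q * ((1 + L) ^+ #|a| - L ^+ #|a|).
  rewrite -sum_subset_expr (bigD1 a) //= [X in X - _]addrC addrK mulr_sumr.
  rewrite [leRHS](eq_bigl (fun b : {set edge n} => b \proper a)); last first.
    by move=> b; rewrite properEneq andbC.
  apply: le_trans (ler_norm_sum _ _ _) _; apply: ler_sum => b ba.
  have ba' := proper_card ba.
  rewrite normrM (ger0_norm (ov_ge0 r01 _ _)).
  apply: (@le_trans _ _ (L ^+ #|b| * rho ^+ #|i0 |: verts b| *
                         rho ^+ #|verts (a :\: b)|)).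
    apply: ler_pM => //; first exact: ov_ge0; last exact: ov_sub.
    by apply: IHm; [exact: leq_trans ba' am|exact: leq_trans (ltnW ba') aD].
  rewrite -mulrA mulrC ler_wpM2r ?exprn_ge0 ?(ltW L0) // -exprD.
  (* Since [rho <= 1], it suffices that [i0 |: verts b] and [verts (a :\: b)] together cover
     [i0 |: verts a]. *)
  apply: ler_wiXn2l => //.
  apply: leq_trans (leq_card_setU _ _); apply/subset_leq_card.
  apply/fintype.subsetP => i; rewrite !inE => /orP[->//|/bigcupP[e ea ie]].
  apply/orP; case: (boolP (e \in b)) => eb; [left; apply/orP|]; right.
    by apply/bigcupP; exists e.
  by apply/bigcupP; exists e; rewrite // inE eb.
(* With [#|a| <= D <= L / 8], the power of [1 + 1/L] is at most [1 + 2 #|a| / L <= 5/4]. *)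
have grow : (1 + L) ^+ #|a| - L ^+ #|a| <= 4^-1 * L ^+ #|a|.
  have -> : (1 + L) ^+ #|a| = (1 + L^-1) ^+ #|a| * L ^+ #|a|.
    by rewrite -exprMn mulrDl mul1r mulVf ?gt_eqF // addrC.
  rewrite -{2}[L ^+ _]mul1r -mulrBl ler_wpM2r ?exprn_ge0 ?(ltW L0) //.
  have aL : #|a|%:R / L <= 8^-1.
    rewrite ler_pdivrMr //.
    have : #|a|%:R <= D%:R :> R by rewrite ler_nat.
    clear -LD; lra.
  rewrite lerBlDr; apply: le_trans (exp1D_le _ _) _; rewrite ?invr_ge0 ?(ltW L0) //;
    rewrite -mulrA; clear -aL; lra.
have La : 8 <= L ^+ #|a|.
  by apply: le_trans L8 _; rewrite -[leLHS]expr1 ler_weXn2l.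
have wov : `|w a| * ov rho a a <= q * (2^-1 * L ^+ #|a|).
  rewrite -[ov _ _ _](ger0_norm (ov_ge0 r01 _ _)) -normrM.
  have -> : w a * ov rho a a = q - S by rewrite -wS addrK.
  apply: le_trans (ler_normB _ _) _; rewrite (ger0_norm q0).
  (* The lone [q] is absorbed because [8 <= L ^+ #|a|]; the resulting 1/2 matches the lower bound on
     [ov rho a a]. *)
  apply: (@le_trans _ _ (q + q * (4^-1 * L ^+ #|a|))).
    by rewrite lerD2l; apply: le_trans S_le _; rewrite ler_wpM2l.
  by rewrite -{1}[q]mulr1 -mulrDr ler_wpM2l // quarter.
have : `|w a| * 2^-1 <= `|w a| * ov rho a a by rewrite ler_wpM2l.
move/le_trans => /(_ _ wov).
by rewrite mulrCA [leRHS]mulrC ler_pM2r ?invr_gt0 // mulrC.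
Qed.

(** [s] is an integral substitute for the square root of [D], and [b] is the cost of one vertex of
    [U]. *)
Lemma MMSE_lower D s : (D <= s ^ 2)%N ->
  let b := 2 * rho ^+ 2 * (512 * D.+1 ^ 4)%:R ^+ (2 * s) in
  2 * n%:R * b <= 1 ->
  rho - (1 + 2 * n%:R * b) * rho ^+ 2 <= MMSE_le n rho D.
Proof.
move=> Ds b nb; have [r0 r1] := andP r01.
have n1 : 1 <= n%:R :> R by rewrite ler1n (leq_ltn_trans _ (ltn_ord i0)).
have b0 : 0 <= b by rewrite !mulr_ge0 ?exprn_ge0 ?ler0n.
(* As [n >= 1], [nb] forces [b <= 1/2], and [D] is at most the power occurring in [b]. *)
have Dr : D%:R * rho ^+ 2 <= 2^-1.
  have DZ : D%:R <= (512 * D.+1 ^ 4)%:R ^+ (2 * s) :> R.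
    rewrite /b in nb b0 *; clear b; case: s Ds nb b0 => [|s] Ds nb b0.
      by move: Ds; rewrite leqn0 => /eqP ->; rewrite muln0 expr0.
    apply: (@le_trans _ _ (512 * D.+1 ^ 4)%:R).
      rewrite ler_nat (leq_trans (leqnSn D)) // (@leq_trans (D.+1 ^ 4)) ?leq_pmull //.
      by rewrite -[leqLHS]expn1 leq_pexp2l.
    by rewrite -[leLHS]expr1 ler_weXn2l // ler1n muln_gt0 expn_gt0.
  have : D%:R * rho ^+ 2 <= 2^-1 * b.
    by rewrite /b -mulrA mulKf ?pnatr_eq0 // mulrC ler_wpM2l ?exprn_ge0.
  nra.
have ov0 a : (#|a| < D.+1)%N -> ov rho a a != 0.
  move=> aD; rewrite gt_eqF //; apply: lt_le_trans (ov_diag r01 a).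
  have : #|a|%:R * rho ^+ 2 <= D%:R * rho ^+ 2.
    by rewrite ler_wpM2r ?exprn_ge0 // ler_nat.
  lra.
have [w wE] := triangular_solve (fun a => rho ^+ #|i0 |: verts a|) ov0.
have wB := @weights_bound D w (8 * D.+1)%:R wE Dr _ _.
apply: lb_le_inf.
  (* The bound on [inf] asks for a nonempty set; the zero polynomial is admissible. *)
  exists (mse rho (0 : polyY R n)), 0 => //=.
  by rewrite /deg_le mpoly.mmeasure0.
move=> _ [f fD <-]; apply: le_trans (mse_ge_weights r01 i0E wE fD).
rewrite lerD2l lerN2.
(* The empty set gives the leading [rho ^+ 2], the nonempty ones the error term. *)
rewrite (bigD1 set0) ?cards0 //= mulrDl mul1r; apply: lerD.
  have := wE set0; rewrite cards0 => /(_ isT).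
  rewrite (big_pred1 set0) => [|a]; last by rewrite subset0.
  by rewrite ov00 mulr1 => ->; rewrite /verts big_set0 setU0 cards1 expr1.
apply: (@le_trans _ _ (rho ^+ 2 * \sum_(a : {set edge n} | (a != set0) && (#|a| <= D)%N)
     ((8 * D.+1)%:R ^+ 2) ^+ #|a| * (rho ^+ 2) ^+ #|verts a :\ i0|)).
  rewrite mulr_sumr; under eq_bigl => a do rewrite andbC.
  apply: ler_sum => a /andP[a0 aD].
  rewrite -(ger0_norm (sqr_ge0 (w a))) normrX.
  apply: (@le_trans _ _ (((8 * D.+1)%:R ^+ #|a| * rho ^+ #|i0 |: verts a|) ^+ 2)).
    rewrite lerXn2r ?nnegrE ?mulr_ge0 ?exprn_ge0 //.
    by apply: wB => //; rewrite -?natrM ler_nat; lia.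
  by rewrite card_vertsU exprMn exprAC [rho ^+ _ ^+ 2]exprAC [X in _ * X <= _]exprS mulrCA.
rewrite mulrC ler_wpM2r ?exprn_ge0 //.
apply: le_trans (sum_edge_sets i0E Ds (exprn_ge0 2 r0)) _; rewrite -/b.
(* The nonempty [U] sum to [(1 + b) ^+ n - 1], at most [2 * n%:R * b]. *)
have := sum_subset_expr (setT : {set 'I_n}) b.
rewrite (bigD1 set0) ?sub0set //= cards0 expr0 cardsT card_ord.
under eq_bigl => U do rewrite subsetT.
have := exp1D_le b0 nb; lra.
Qed.

End LowerBound.

(** * Asymptotics: the error term is a negative power of [n] *)

Local Open Scope classical_set_scope.

Lemma near_ln_ge (R : realType) (K : R) : \forall n \near \oo, K <= ln (n%:R : R).
Proof.
exists (Num.truncn (expR K)).+1 => // n /= Kn.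
have : expR K < n%:R.
  by apply: lt_le_trans (truncnS_gt _) _; rewrite ler_nat.
by move=> h; rewrite -[K]expRK ler_ln ?posrE ?expR_gt0 ?(ltW h) // (lt_trans (expR_gt0 _) h).
Qed.

(** For positive [n] the sequence is [4 n^(-e)]. *)
Lemma cvg_expR_ln (R : realType) (e : R) : 0 < e ->
  (fun n : nat => 4 * expR (- (e * ln n%:R)) : R) @ \oo --> 0.
Proof.
move=> e0; apply/cvgrPdist_le => d d0.
have := near_ln_ge (- ln (d / 4) / e); apply: filterS => n h.
rewrite sub0r normrN ger0_norm ?mulr_ge0 ?expR_ge0 // mulrC -ler_pdivlMr //.
have d4 : 0 < d / 4 by rewrite divr_gt0.
rewrite -[leRHS]lnK ?posrE // ler_expR lerNl.
by rewrite [leRHS]mulrC -ler_pdivrMr.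
Qed.

(** [ln x = 2 ln (sqrt x) <= 2 sqrt x], and the hypothesis says [sqrt x >= 2 / a]. *)
Lemma ln_le_mul (R : realType) (a x : R) : 0 < a -> 4 / a ^+ 2 <= x -> ln x <= a * x.
Proof.
move=> a0 ax.
have x0 : 0 < x by apply: lt_le_trans ax; rewrite divr_gt0 ?exprn_gt0.
have sx : 0 < Num.sqrt x by rewrite sqrtr_gt0.
have xE : x = Num.sqrt x ^+ 2 by rewrite sqr_sqrtr ?ltW.
have l1 : ln (Num.sqrt x) <= Num.sqrt x.
  rewrite -ler_expR lnK ?posrE //; apply: le_trans (expR_ge1Dx _); lra.
have a2 : 2 <= a * Num.sqrt x.
  rewrite -(@ler_pXn2r _ 2) ?nnegrE ?mulr_ge0 ?(ltW a0) ?(ltW sx) // exprMn -xE.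
  move: ax; rewrite ler_pdivrMr ?exprn_gt0 // mulrC; lra.
rewrite {1}xE lnXn // mulr2n; rewrite [X in _ * X]xE.
have : 0 <= (a * Num.sqrt x - 2) * Num.sqrt x.
  by rewrite mulr_ge0 ?subr_ge0 // ltW.
lra.
Qed.

(** Here [l] stands for [ln n], so the bound is [n^(36 a)]. The base is at most [l ^+ 9] and [s] at
    most [2 a l / ln l], hence [18 s ln l <= 36 a l]. *)
Lemma pow_bound (R : realType) (a l : R) (D : nat) :
  0 < a -> a <= 1 -> 512 * 2 ^+ 4 <= l -> 1 <= ln l -> ln l <= a * l ->
  D%:R <= a ^+ 2 * (l / ln l) ^+ 2 ->
  exists s, (D <= s ^ 2)%N /\
    (512 * D.+1 ^ 4)%:R ^+ (2 * s) <= expR (36 * a * l).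
Proof.
move=> a0 a1 l8 ll1 lla Dle.
have l0 : 0 < l by apply: lt_le_trans l8; rewrite mulr_gt0 ?exprn_gt0 ?ltr0n.
have l1 : 1 <= l.
  by apply: le_trans l8; rewrite mulr_ege1 ?exprn_ege1 ?ler1n.
have ll0 : 0 < ln l by lra.
pose q := a * (l / ln l).
have q0 : 0 <= q by rewrite !mulr_ge0 ?invr_ge0 // ltW.
have qll : q * ln l = a * l by rewrite /q mulrA divfK // gt_eqF.
(* This makes rounding up cheap: [s <= q + 1 <= 2 q]. *)
have q1 : 1 <= q by rewrite /q mulrA ler_pdivlMr // mul1r.
exists (Num.truncn q).+1; set s := _.+1; split.
  rewrite -(ler_nat R) natrX; apply: le_trans Dle _.
  rewrite -exprMn lerXn2r ?nnegrE // ltW //; exact: truncnS_gt.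
have sq : s%:R <= 2 * q.
  have : (Num.truncn q)%:R <= q by rewrite truncn_le.
  by rewrite /s -natr1; lra.
have ql : q <= l.
  rewrite /q mulrA ler_pdivrMr //; apply: (@le_trans _ _ (1 * l)).
    by rewrite ler_wpM2r // ltW.
  by rewrite mul1r ler_peMr // ltW.
have N2 : D.+1%:R <= 2 * l ^+ 2.
  have : D%:R <= q ^+ 2 by rewrite /q exprMn.
  rewrite -natr1; nra.
(* The ninth factor [l] absorbs the constant [512 * 2 ^+ 4]. *)
have Z9 : (512 * D.+1 ^ 4)%:R <= l ^+ 9.
  rewrite natrM natrX; apply: (@le_trans _ _ (512 * (2 * l ^+ 2) ^+ 4)).
    by rewrite ler_wpM2l ?lerXn2r ?nnegrE ?mulr_ge0 ?ler0n ?exprn_ge0 // ltW.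
  have -> : 512 * (2 * l ^+ 2) ^+ 4 = 512 * 2 ^+ 4 * l ^+ 8.
    by rewrite exprMn -exprM mulrA.
  by rewrite [leRHS]exprS ler_wpM2r // exprn_ge0 // ltW.
apply: (@le_trans _ _ ((l ^+ 9) ^+ (2 * s))).
  by rewrite lerXn2r ?nnegrE ?ler0n ?exprn_ge0 ?(ltW l0).
rewrite -exprM -[l in leLHS]lnK ?posrE // -expRM_natl ler_expR.
rewrite !natrM.
have : s%:R * ln l <= 2 * q * ln l by rewrite ler_wpM2r // ltW.
by rewrite -mulrA qll; lra.
Qed.

(** In powers of [n]: [rho <= n^(-1/2 - eps)] gives [n rho^2 <= n^(-2 eps)], and the power from
    [pow_bound] costs at most [n^(36 a) <= n^eps], which leaves [n^(-eps)]. *)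
Lemma MMSE_lower_eps (R : realType) (n k D : nat) (eps a : R) :
  let l : R := ln n%:R in let rho : R := k%:R / n%:R in
  (0 < n)%N -> 0 < a -> a <= 1 -> 36 * a <= eps ->
  512 * 2 ^+ 4 <= l -> 1 <= ln l -> ln l <= a * l ->
  D%:R <= a ^+ 2 * (l / ln l) ^+ 2 ->
  k%:R <= n%:R `^ (2^-1 - eps) ->
  4 * expR (- (eps * l)) <= 1 ->
  rho - (1 + 4 * expR (- (eps * l))) * rho ^+ 2 <= MMSE_le n rho D.
Proof.
move=> l rho n0 a0 a1 ae l8 ll1 lla Dle kle d1.
have [s [Ds sZ]] := pow_bound a0 a1 l8 ll1 lla Dle.
have n0R : 0 < n%:R :> R by rewrite ltr0n.
have l1 : 1 <= l.
  by apply: le_trans l8; rewrite mulr_ege1 ?exprn_ege1 ?ler1n.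
clear l8.
have nE : n%:R = expR l :> R by rewrite lnK ?posrE.
have kE : k%:R <= expR ((2^-1 - eps) * l).
  by move: kle; rewrite /powR gt_eqF.
have rho0 : 0 <= rho by rewrite divr_ge0.
have rhoE : rho <= expR ((- 2^-1 - eps) * l).
  rewrite /rho ler_pdivrMr // nE -expRD; apply: le_trans kE _.
  by rewrite ler_expR; lra.
have e0 : 0 < eps by lra.
have l0 : 0 <= l by apply: le_trans l1.
have el : 0 <= eps * l by rewrite mulr_ge0 // ltW.
have rho1 : rho <= 1 by apply: le_trans rhoE _; rewrite -[leRHS]expR0 ler_expR; lra.
have r01 : 0 <= rho <= 1 by rewrite rho0.
have nrho2 : n%:R * rho ^+ 2 <= expR (- (2 * eps * l)).
  rewrite nE; apply: (@le_trans _ _ (expR l * expR ((- 2^-1 - eps) * l) ^+ 2)).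
    by rewrite ler_wpM2l ?expR_ge0 // lerXn2r ?nnegrE ?expR_ge0.
  by rewrite -expRM_natl -expRD ler_expR; lra.
pose Z : R := (512 * D.+1 ^ 4)%:R ^+ (2 * s).
have Z0 : 0 <= Z by rewrite exprn_ge0 ?ler0n.
have bE : 2 * n%:R * (2 * rho ^+ 2 * Z) <= 4 * expR (- (eps * l)).
  have -> : 2 * n%:R * (2 * rho ^+ 2 * Z) = 4 * (n%:R * rho ^+ 2 * Z) by ring.
  rewrite ler_pM2l //.
  apply: (@le_trans _ _ (expR (- (2 * eps * l)) * expR (36 * a * l))).
    by apply: (ler_pM _ Z0 nrho2 sZ); rewrite mulr_ge0 ?ler0n ?exprn_ge0.
  rewrite -expRD ler_expR.
  have : 36 * a * l <= eps * l by rewrite ler_wpM2r //; lra.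
  lra.
have := @MMSE_lower R n rho (Ordinal n0) r01 erefl D s Ds (le_trans bE d1).
apply: le_trans; rewrite lerD2l lerN2 ler_wpM2r ?exprn_ge0 // lerD2l //.
Qed.

Theorem mainTheorem8 (R : realType) (k D : nat -> nat) (eps : R) :
  0 < eps ->
  (forall n : nat, (k n)%:R <= (n%:R) `^ (2^-1 - eps)) ->
  (forall c : R, 0 < c ->
     \forall n \near \oo, (D n)%:R <= c * (ln n%:R / ln (ln n%:R)) ^+ 2) ->
  exists delta : nat -> R,
    delta @ \oo --> 0 /\
    \forall n \near \oo,
      let rho := (k n)%:R / n%:R in
      rho - (1 + delta n) * rho ^+ 2 <= MMSE_le n rho (D n).
Proof.
move=> e0 kle Dle; exists (fun n => 4 * expR (- (eps * ln n%:R))).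
have dcvg := cvg_expR_ln e0; split=> //.
(* The 36 is the constant in the exponent of [pow_bound], which also asks for [a <= 1]. *)
pose a : R := Num.min 1 (eps / 36).
have a0 : 0 < a by rewrite lt_min ltr01 divr_gt0.
have a1 : a <= 1 by rewrite ge_min lexx.
have ae : 36 * a <= eps.
  by rewrite mulrC -ler_pdivlMr // ge_min lexx orbT.
near=> n; apply: (@MMSE_lower_eps R n (k n) (D n) eps a) => //.
- by near: n; exists 1%N.
- by near: n; exact: near_ln_ge.
- have : expR 1 <= ln n%:R :> R by near: n; exact: near_ln_ge.
  move=> h; rewrite -[leLHS]expRK ler_ln ?posrE ?expR_gt0 //.
  exact: lt_le_trans (expR_gt0 1) h.
- by apply: ln_le_mul => //; near: n; exact: near_ln_ge.
(* The little-o assumption enters with [c = a ^+ 2]. *)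
- by near: n; apply: Dle; rewrite exprn_gt0.
- near: n; have /cvgrPdist_le/(_ 1 ltr01) := dcvg; apply: filterS => n.
  by rewrite sub0r normrN; apply: le_trans; exact: ler_norm.
Unshelve. all: by end_near.
Qed.
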